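(* Let $S_1$ and $S_2$ be finite-dimensional semi-simple $\mathbb{C}$-algebras and let $(Q,\alpha)$ be the quiver setting associated to the algebra coproduct $S_1 \ast S_2$. Then the quiver $Q$ is symmetric, that is, the path algebra $\mathbb{C}Q$ is symplectic.
   Context: All algebras are associative $\mathbb{C}$-algebras with unit. $S_1 \ast S_2$ is the coproduct (free product over $\mathbb{C}$) in the category of unital $\mathbb{C}$-algebras; it is a formally smooth algebra. Symmetric/symplectic. A quiver $Q$ is called symmetric if there is an involution $a\mapsto a^*$ on its arrows such that $a^*$ has the reverse orientation of $a$; in this case $Q$, or its path algebra $\mathbb{C}Q$, is said to be symplectic (to be equipped with a symplectic structure). In this statement the meaning is only that the number of arrows between two different vertices is equal in each direction; it is not claimed that the number of loops in a vertex is even (for example, the quiver associated to $M_2(\mathbb{C})\ast M_2(\mathbb{C})$ is the one-vertex quiver with three loops). The quiver setting $(Q,\alpha)$ associated to $S_1\ast S_2$ is described as follows. Write $S_1 = M_{k_1}(\mathbb{C}) \oplus \dots \oplus M_{k_r}(\mathbb{C})$ and $S_2 = M_{l_1}(\mathbb{C}) \oplus \dots \oplus M_{l_s}(\mathbb{C})$. Let $\Lambda$ be the bipartite quiver with $r$ left vertices and $s$ right vertices having $k_il_j$ arrows from the $i$-th left vertex to the $j$-th right vertex (and no other arrows), with Euler form on $\mathbb{Z}^{r+s}$ $$\chi_\Lambda\big((a;b),(c;d)\big) = \sum_{i=1}^r a_ic_i + \sum_{j=1}^s b_jd_j - \sum_{i=1}^r\sum_{j=1}^s k_il_j\,a_id_j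 .$$ Let $\mathrm{comp}\subset\mathbb{N}^{r+s}$ be the semigroup of vectors $(a_1,\dots,a_r;b_1,\dots,b_s)$ with $\sum_i k_ia_i = \sum_j l_jb_j$ (these index the connected components of the varieties of $n$-dimensional representations of $S_1\ast S_2$, $n = \sum_i k_ia_i$, via the multiplicities of the simple $S_1$- and $S_2$-modules in the restrictions). Let $\beta_1,\dots,\beta_m$ be its semigroup generators. Then $Q$ has $m$ vertices, corresponding to $\beta_1,\dots,\beta_m$, and the number of arrows from vertex $u$ to vertex $v$ is $\delta_{uv}-\chi_\Lambda(\beta_u,\beta_v)$. The $u$-th component of the dimension vector $\alpha$ is $\sum_i k_i a_i$ if $\beta_u=(a_1,\dots,a_r;b_1,\dots,b_s)$. *)

(* Defs.v *)
From HB Require Import structures.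
From mathcomp Require Import all_boot all_order all_algebra all_field.

Set Implicit Arguments.
Unset Strict Implicit.
Unset Printing Implicit Defensive.

Import Order.TTheory GRing.Theory Num.Theory.
Local Open Scope ring_scope.

Section Semisimple.
Variables (K : fieldType) (A : falgType K).

Definition left_ideal (I : {vspace A}) : Prop := (fullv * I <= I)%VS.

Definition simple_left_ideal (I : {vspace A}) : Prop :=
  [/\ left_ideal I, I <> 0%VS &
      forall J : {vspace A}, left_ideal J -> (J <= I)%VS -> J = 0%VS \/ J = I].

(* The regular left module is a finite direct sum of simple submodules. *)
Definition semisimple_algebra : Prop :=
  exists (n : nat) (I : 'I_n -> {vspace A}),
    [/\ forall i, simple_left_ideal (I i),
        directv (\sum_(i < n) I i)%VS &
        (\sum_(i < n) I i)%VS = fullv].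

(* An isomorphism of A with M_(k_0)(K) (+) ... (+) M_(k_(r-1))(K), given by    *)
(* its components: phi i is a morphism of unital algebras for each i, and     *)
(* together they form a bijection onto the product.                           *)
Definition matrix_decomposition (r : nat) (k : 'I_r -> nat) : Prop :=
  (forall i, (0 < k i)%N) /\
  exists phi : forall i : 'I_r, {lrmorphism A -> 'M[K]_(k i)},
    forall y : (forall i : 'I_r, 'M[K]_(k i)),
      exists! x : A, forall i, phi i x = y i.

End Semisimple.

Record quiver := Quiver {
  vertex : finType;
  arrow : finType;
  source : arrow -> vertex;
  target : arrow -> vertex }.

Definition arrows_between (Q : quiver) (u v : vertex Q) : nat :=
  #|[set a : arrow Q | (source a == u) && (target a == v)]|.

(* The involution is allowed to fix loops, so that no parity condition is     *)
(* imposed on the number of loops at a vertex.                                *)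
Definition symmetric_quiver (Q : quiver) : Prop :=
  exists star : arrow Q -> arrow Q,
    involutive star /\
    forall a, source (star a) = target a /\ target (star a) = source a.

Section QuiverSetting.
Variables (r s : nat) (k : 'I_r -> nat) (l : 'I_s -> nat).

(* Vectors (a; b) in N^(r+s). *)
Definition mult_vec : Type := ({ffun 'I_r -> nat} * {ffun 'I_s -> nat})%type.

(* The Euler form of the bipartite quiver with k_i * l_j arrows from the i-th *)
(* left to the j-th right vertex, at vectors of Z^(r+s).                      *)
Definition euler_bipartite (x y : {ffun 'I_r -> int} * {ffun 'I_s -> int}) :
    int :=
  \sum_(i < r) x.1 i * y.1 i + \sum_(j < s) x.2 j * y.2 j
  - \sum_(i < r) \sum_(j < s) (k i * l j)%:Z * x.1 i * y.2 j.

Definition int_vec (x : mult_vec) : {ffun 'I_r -> int} * {ffun 'I_s -> int} :=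
  ([ffun i => (x.1 i)%:Z], [ffun j => (x.2 j)%:Z]).

Definition comp_semigroup : pred mult_vec :=
  fun x => (\sum_(i < r) k i * x.1 i == \sum_(j < s) l j * x.2 j)%N.

(* beta is the minimal generating family of comp_semigroup under addition: it *)
(* generates, and no beta_u is a combination of the others. As the empty sum  *)
(* is allowed, the zero vector is not among the generators.                   *)
Definition semigroup_generators (V : finType) (beta : V -> mult_vec) : Prop :=
  [/\ forall u, comp_semigroup (beta u),
      forall x, comp_semigroup x -> exists c : V -> nat, x = \sum_u beta u *+ c u &
      forall u (c : V -> nat), beta u <> \sum_(v | v != u) beta v *+ c v].

Definition bipartite_quiver_setting (Q : quiver) (alpha : vertex Q -> nat) :
    Prop :=
  exists beta : vertex Q -> mult_vec,
    [/\ semigroup_generators beta,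
        forall u v, (arrows_between u v)%:Z =
          (u == v)%:Z - euler_bipartite (int_vec (beta u)) (int_vec (beta v)) &
        forall u, alpha u = (\sum_(i < r) k i * (beta u).1 i)%N].

End QuiverSetting.

(* (Q, alpha) is the quiver setting of the coproduct S1 * S2 over K; it is     *)
(* determined, up to relabelling, by the sizes k and l of the matrix blocks   *)
(* of the two factors.                                                        *)
Definition coproduct_quiver_setting (K : fieldType) (S1 S2 : falgType K)
    (Q : quiver) (alpha : vertex Q -> nat) : Prop :=
  exists (r s : nat) (k : 'I_r -> nat) (l : 'I_s -> nat),
    [/\ matrix_decomposition S1 k, matrix_decomposition S2 l &
        bipartite_quiver_setting k l alpha].

(* Main.v *)
Require Import Defs.
From HB Require Import structures.
From mathcomp Require Import all_boot all_order all_algebra all_field.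
From mathcomp Require Import reals.
From mathcomp.real_closed Require Import complex.

Import Order.TTheory GRing.Theory Num.Theory.
Local Open Scope ring_scope.

(** If x and y lie in comp, the bilinear correction term of the Euler form
    factors as (sum_i k_i a_i) (sum_j l_j d_j) = n(x) n(y), where n is the total
    dimension. Hence the Euler form is symmetric on comp, and Q has as many
    arrows from u to v as from v to u. *)

Lemma symmetric_quiver_arrows (Q : quiver) :
  (forall u v : vertex Q, arrows_between u v = arrows_between v u) ->
  symmetric_quiver Q.
Proof.
move=> symQ.
pose E (u v : vertex Q) :=
  enum [set a : arrow Q | (source a == u) && (target a == v)].
have sizeE u v : size (E u v) = size (E v u) by rewrite -!cardE; apply: symQ.
have memE u v a : (a \in E u v) = (source a == u) && (target a == v).
  by rewrite mem_enum inE.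
(* The n-th arrow from u to v is paired with the n-th arrow from v to u; in
   particular every loop is fixed. *)
pose star a :=
  nth a (E (target a) (source a)) (index a (E (source a) (target a))).
have index_lt a :
    (index a (E (source a) (target a)) < size (E (target a) (source a)))%N.
  by rewrite sizeE index_mem memE !eqxx.
have starP a : source (star a) = target a /\ target (star a) = source a.
  have := mem_nth a (index_lt a).
  by rewrite memE => /andP[/eqP sa /eqP ta].
exists star; split=> // a.
have [sa ta] := starP a.
(* The enumerations have no repetitions, so [star a] has in the reversed list the same index as [a]
   in its own; applying [star] again returns to that index. *)
rewrite {1}/star sa ta /star index_uniq ?index_lt ?enum_uniq //.
have mem_a : a \in E (source a) (target a) by rewrite memE !eqxx.
(* The default of the outer [nth] is still [star a]; the index is in range, so it may be replaced by
   [a]. *)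
by rewrite (set_nth_default a) ?index_mem // nth_index.
Qed.

(** The balance condition on [y] trades its right-hand dimension sum for the left-hand one, which
    makes the formula visibly symmetric in [x] and [y]. *)
Lemma euler_bipartite_comp (r s : nat) (k : 'I_r -> nat) (l : 'I_s -> nat)
    (x y : mult_vec r s) :
  comp_semigroup k l y ->
  euler_bipartite k l (int_vec x) (int_vec y) =
    \sum_(i < r) (x.1 i)%:Z * (y.1 i)%:Z
    + \sum_(j < s) (x.2 j)%:Z * (y.2 j)%:Z
    - (\sum_(i < r) k i * x.1 i)%N%:Z * (\sum_(i < r) k i * y.1 i)%N%:Z.
Proof.
move=> /eqP ->; rewrite /euler_bipartite; congr (_ + _ - _).
- by apply: eq_bigr => i _; rewrite !ffunE.
- by apply: eq_bigr => j _; rewrite !ffunE.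
(* The product of the two dimensions is expanded into a double sum over [nat] before [Posz] is
   pushed inside. *)
rewrite -PoszM big_distrlr /= (big_morph Posz PoszD erefl).
apply: eq_bigr => i _; rewrite (big_morph Posz PoszD erefl).
by apply: eq_bigr => j _; rewrite !ffunE -!PoszM -mulnA mulnACA mulnA.
Qed.

Lemma euler_bipartite_sym (r s : nat) (k : 'I_r -> nat) (l : 'I_s -> nat)
    (x y : mult_vec r s) :
  comp_semigroup k l x -> comp_semigroup k l y ->
  euler_bipartite k l (int_vec x) (int_vec y) =
  euler_bipartite k l (int_vec y) (int_vec x).
Proof.
move=> compx compy; rewrite !euler_bipartite_comp //.
congr (_ + _ - _); last exact: mulrC.
  by apply: eq_bigr => i _; rewrite mulrC.
by apply: eq_bigr => j _; rewrite mulrC.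
Qed.

(* The complex numbers are R[i] for R : realType. *)
Theorem proposition3 (R : realType) (S1 S2 : falgType R[i])
    (ss1 : semisimple_algebra S1) (ss2 : semisimple_algebra S2)
    (Q : quiver) (alpha : vertex Q -> nat)
    (HQ : coproduct_quiver_setting S1 S2 alpha) :
  symmetric_quiver Q.
Proof.
have [r [s [k [l [_ _ [beta [[compb _ _] arrowsE _]]]]]]] := HQ.
apply: symmetric_quiver_arrows => u v.
apply/eqP; rewrite -eqz_nat !arrowsE (eq_sym u v).
by rewrite (@euler_bipartite_sym _ _ _ _ (beta u)).
Qed.
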